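(* Let $m\ge k\ge 1$, let $\tau_1,\dots,\tau_k\in\mathbb{R}^m$ be linearly independent, let $M$ be the real $m\times k$ matrix with columns $\tau_1,\dots,\tau_k$, and let $H=M(M^{T}M)^{-1}M^{T}$ be the Hat matrix of $M$. Let $S=\{y\in\mathbb{R}^m : (\tau_j,y)=0,\ j=1,\dots,k\}$. Then for every $g\in\mathbb{R}^m$ the projection of $g$ in $S$ is $$g\downarrow_S \;=\; g-Hg .$$
   Context: $(\cdot,\cdot)$ is the standard inner product on $\mathbb{R}^m$ and $d$ is the associated Euclidean distance. For a real $m\times k$ matrix $M$ of full rank with $m\ge k$, the matrix $M^{T}M$ is symmetric and invertible, and the Hat matrix with respect to $M$ is $H=M(M^{T}M)^{-1}M^{T}$. For a linear subspace $S\subseteq\mathbb{R}^m$ and $g\in\mathbb{R}^m$, the projection $g\downarrow_S$ of $g$ in $S$ is the unique point $p\in S$ such that $d(g,p)\le d(g,y)$ for all $y\in S$. *)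

(* Defs.v *)
From HB Require Import structures.
From mathcomp Require Export all_boot all_order all_algebra.
From mathcomp Require Export reals.

Set Implicit Arguments.
Unset Strict Implicit.
Unset Printing Implicit Defensive.

Import Order.TTheory GRing.Theory Num.Theory.
Local Open Scope ring_scope.

Section Defs.
Variables (R : realType) (m : nat).
Implicit Types (x y g p : 'cV[R]_m).

Definition inner x y : R := \sum_(i < m) x i 0 * y i 0.

Definition edist x y : R := Num.sqrt (inner (x - y) (x - y)).

(* invmx A is the inverse only when A \in unitmx; here M^T *m M is invertible
   when M has full column rank. *)
Definition hat_mx k (M : 'M[R]_(m, k)) : 'M[R]_m :=
  M *m invmx (M^T *m M) *m M^T.

Definition cols_mx k (tau : k.-tuple 'cV[R]_m) : 'M[R]_(m, k) :=
  \matrix_(i < m, j < k) tnth tau j i 0.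

Definition orth_space k (tau : k.-tuple 'cV[R]_m) : {pred 'cV[R]_m} :=
  fun y => [forall j : 'I_k, inner (tnth tau j) y == 0].

Fact orth_space_submod_closed k (tau : k.-tuple 'cV[R]_m) :
  submod_closed (orth_space tau).
Proof.
split=> [|a u v /forallP hu /forallP hv]; apply/forallP=> j; apply/eqP.
  by rewrite /inner big1 // => i _; rewrite mxE mulr0.
have -> : inner (tnth tau j) (a *: u + v) =
          a * inner (tnth tau j) u + inner (tnth tau j) v.
  rewrite /inner mulr_sumr -big_split; apply: eq_bigr => i _ /=.
  by rewrite !mxE mulrDr mulrCA.
by rewrite (eqP (hu j)) (eqP (hv j)) mulr0 addr0.
Qed.

HB.instance Definition _ k (tau : k.-tuple 'cV[R]_m) :=
  GRing.isSubmodClosed.Build R 'cV[R]_m (orth_space tau)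
    (orth_space_submod_closed tau).

Definition nearest (S : submodClosed 'cV[R]_m) g p : Prop :=
  p \in S /\ forall y, y \in S -> edist g p <= edist g y.

Definition is_projection (S : submodClosed 'cV[R]_m) g p : Prop :=
  unique (nearest S g) p.

End Defs.

(* Main.v *)
Require Import Defs.

Set Implicit Arguments.
Unset Strict Implicit.
Unset Printing Implicit Defensive.

Import Order.TTheory GRing.Theory Num.Theory.
Local Open Scope ring_scope.

(** Linear independence of the columns of [M] makes the Gram matrix [M^T M]
    invertible, so [M^T (g - H g) = 0], i.e. [g - H g] lies in [S = ker M^T].
    As [H g] lies in the column space of [M], it is orthogonal to [S], and
    Pythagoras gives [d(g, y)^2 = |H g|^2 + d(g - H g, y)^2] for [y] in [S]:
    the minimum is attained at [y = g - H g] and nowhere else. *)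

Section Inner.
Variables (R : realType) (m : nat).
Implicit Types x y : 'cV[R]_m.

Lemma inner_mulmx x y : inner x y = (x^T *m y) 0 0.
Proof. by rewrite mxE; apply: eq_bigr => i _; rewrite mxE. Qed.

Lemma inner_ge0 x : 0 <= inner x x.
Proof. by apply: sumr_ge0 => i _; rewrite -expr2 sqr_ge0. Qed.

Lemma inner_eq0 x : (inner x x == 0) = (x == 0).
Proof.
apply/eqP/eqP => [|->]; last by rewrite inner_mulmx mulmx0 mxE.
move/psumr_eq0P => x0; apply/matrixP => i j; rewrite ord1 mxE.
apply/eqP; rewrite -sqrf_eq0 expr2; apply/eqP/x0 => // l _.
by rewrite -expr2 sqr_ge0.
Qed.

Lemma inner_addr_orth x y : inner x y = 0 ->
  inner (x + y) (x + y) = inner x x + inner y y.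
Proof.
move=> xy0; have yx0 : inner y x = 0.
  by rewrite -xy0; apply: eq_bigr => i _; rewrite mulrC.
rewrite !inner_mulmx in xy0 yx0 *.
rewrite [(x + y)^T]linearD /= mulmxDl !mulmxDr mxE [X in X + _]mxE [X in _ + X]mxE.
by rewrite xy0 yx0 addr0 add0r.
Qed.

(** Moving [M] across the inner product gives [v^T (M^T y)]. Serves both for the Gram matrix, with
    [y] itself in the column space, and for Pythagoras. *)
Lemma inner_mulmxl k (M : 'M[R]_(m, k)) (v : 'cV[R]_k) y :
  M^T *m y = 0 -> inner (M *m v) y = 0.
Proof. by move=> My0; rewrite inner_mulmx trmx_mul -mulmxA My0 mulmx0 mxE. Qed.

(** If [M^T M w = 0], then [M w] is orthogonal to itself, hence zero, and injectivity of [M] gives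
    [w = 0]. *)
Lemma gram_unitmx k (M : 'M[R]_(m, k)) :
  (forall v : 'cV[R]_k, M *m v = 0 -> v = 0) -> M^T *m M \in unitmx.
Proof.
move=> injM; rewrite -row_free_unit -kermx_eq0; apply/rowV0P => v.
move/sub_kermxP => vG0; apply: trmx_inj; rewrite trmx0; apply: injM.
apply/eqP; rewrite -inner_eq0; apply/eqP/inner_mulmxl.
(* The kernel vector [v] is a row; as the Gram matrix is symmetric, transposing turns the goal into
   [v (M^T M) = 0]. *)
by apply: trmx_inj; rewrite mulmxA !trmx_mul !trmxK trmx0.
Qed.

Lemma mul_tr_hat_mx k (M : 'M[R]_(m, k)) :
  M^T *m M \in unitmx -> M^T *m hat_mx M = M^T.
Proof. by move=> uG; rewrite /hat_mx !mulmxA mulmxV // mul1mx. Qed.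

Lemma mul_cols_mx k (tau : k.-tuple 'cV[R]_m) (v : 'cV[R]_k) :
  cols_mx tau *m v = \sum_(j < k) v j 0 *: tnth tau j.
Proof.
apply/matrixP => i j; rewrite ord1 mxE summxE.
by apply: eq_bigr => l _; rewrite !mxE mulrC.
Qed.

Lemma free_cols_mx_inj k (tau : k.-tuple 'cV[R]_m) (v : 'cV[R]_k) :
  free tau -> cols_mx tau *m v = 0 -> v = 0.
Proof.
move/freeP => freet; rewrite mul_cols_mx => Mv0.
apply/matrixP => j i; rewrite ord1 mxE; apply: (freet (fun l => v l 0)) j.
by rewrite -[RHS]Mv0; apply: eq_bigr => j _; rewrite (tnth_nth 0).
Qed.

(** The rows of the transposed matrix are the [tau_j], so the defining equations of the space become
    one matrix equation. *)
Lemma orth_spaceP k (tau : k.-tuple 'cV[R]_m) y :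
  reflect ((cols_mx tau)^T *m y = 0) (y \in orth_space tau).
Proof.
have innerE j : ((cols_mx tau)^T *m y) j 0 = inner (tnth tau j) y.
  by rewrite mxE; apply: eq_bigr => i _; rewrite !mxE.
apply: (iffP forallP) => [y0|My0 j]; last by rewrite -innerE My0 mxE.
by apply/matrixP => j i; rewrite ord1 innerE (eqP (y0 j)) mxE.
Qed.

End Inner.

Theorem theorem5p3 (R : realType) (m k : nat) (hk : (1 <= k)%N)
    (hmk : (k <= m)%N) (tau : k.-tuple 'cV[R]_m) (htau : free tau)
    (g : 'cV[R]_m) :
  is_projection (orth_space tau) g (g - hat_mx (cols_mx tau) *m g).
Proof.
set M := cols_mx tau; set h := hat_mx M *m g; set p := g - h.
have uG : M^T *m M \in unitmx.
  by apply: gram_unitmx => v; apply: free_cols_mx_inj.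
have Mp0 : M^T *m p = 0 by rewrite mulmxBr mulmxA mul_tr_hat_mx // subrr.
have pS : p \in orth_space tau by apply/orth_spaceP.
have gp : g - p = h by rewrite /p opprB addrC subrK.
have pyth y : y \in orth_space tau ->
    inner (g - y) (g - y) = inner h h + inner (p - y) (p - y).
  move/orth_spaceP => My0; rewrite -inner_addr_orth.
    by rewrite addrA /p [h + _]addrC subrK.
  (* Reassociated, [h] is [M] times a vector, while [M^T] kills both [p] and [y]. *)
  by rewrite /h /hat_mx -!mulmxA inner_mulmxl // mulmxBr Mp0 My0 subrr.
split=> [|q [qS qmin]].
  split=> // y yS; rewrite ler_sqrt ?inner_ge0 // gp pyth //.
  by rewrite lerDl inner_ge0.
(* Testing the minimality of [q] against [p] gives [|h|^2 + |p - q|^2 <= |h|^2], which forces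
   [q = p]. *)
have := qmin p pS; rewrite ler_sqrt ?inner_ge0 // gp pyth // gerDl => pq_le0.
apply/eqP; rewrite -subr_eq0 -inner_eq0.
by apply/eqP/le_anti; rewrite pq_le0 inner_ge0.
Qed.
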